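(* Let $G$ and $H$ be nontrivial graphs with $G$ connected. Then $${\rm gp}(G\circ H)=\max_{S\in\mathcal{G}_{2,2}}\big\{|\mathcal{I}_S|\,{\rm sjc}_2(H)+|\mathcal{J}_S|\,\omega(H)\big\}.$$
   Context: Graphs are finite and simple; nontrivial means at least two vertices. The lexicographic product $G\circ H$ has vertex set $V(G)\times V(H)$, with $(g,h)$ adjacent to $(g',h')$ iff $gg'\in E(G)$, or $g=g'$ and $hh'\in E(H)$. A general position set of a graph $X$ is a set of vertices no three of which lie on a common shortest path; ${\rm gp}(X)$ is the largest size of a general position set. $\mathcal{G}_{2,2}$ is the family of all general position sets of $G$. For $S\subseteq V(G)$, $\mathcal{I}_S$ is the set of isolated vertices of the induced subgraph $G[S]$ and $\mathcal{J}_S=S\setminus\mathcal{I}_S$. $\omega(H)$ is the clique number of $H$. For a graph $X$ and nonempty $W\subseteq V(X)$, $d_X(W)$ is the minimum number of edges of a connected subgraph of $X$ containing $W$ ($\infty$ if none). A set $A\subseteq V(H)$ with $|A|\ge 2$ is $2$-Steiner join-critical if $d_{H[A]}(B)\ne 2$ for every $2$-subset $B\subseteq A$ (where $H[A]$ is the induced subgraph); ${\rm sjc}_2(H)$ is the largest size of such a set. *)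

(* Defs.v *)
From HB Require Import structures.
From mathcomp Require Import all_boot.
From mathcomp Require Import boolp.

Set Implicit Arguments.
Unset Strict Implicit.
Unset Printing Implicit Defensive.

Record sgraph := SGraph {
  vertex :> finType;
  edge : rel vertex;
  edge_sym : symmetric edge;
  edge_irrefl : irreflexive edge }.

Definition nontrivial (X : sgraph) : Prop := 1 < #|X|.

Definition connected (X : sgraph) : Prop := forall x y : X, connect (@edge X) x y.

Section Induced.
Variables (X : sgraph) (A : {set X}).

Definition induced_edge : rel {x : X | x \in A} := fun x y => edge (val x) (val y).

Lemma induced_edge_sym : symmetric induced_edge.
Proof. by move=> x y; apply: edge_sym. Qed.

Lemma induced_edge_irrefl : irreflexive induced_edge.
Proof. by move=> x; apply: edge_irrefl. Qed.

Definition induced : sgraph := SGraph induced_edge_sym induced_edge_irrefl.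
End Induced.

Section LexicographicProduct.
Variables G H : sgraph.

Definition lex_edge : rel (G * H) :=
  fun u v => edge u.1 v.1 || ((u.1 == v.1) && edge u.2 v.2).

Lemma lex_edge_sym : symmetric lex_edge.
Proof. by move=> u v; rewrite /lex_edge eq_sym (edge_sym u.1) (edge_sym u.2). Qed.

Lemma lex_edge_irrefl : irreflexive lex_edge.
Proof. by move=> u; rewrite /lex_edge !edge_irrefl andbF. Qed.

Definition lexprod : sgraph := SGraph lex_edge_sym lex_edge_irrefl.
End LexicographicProduct.

Section GeneralPosition.
Variable X : sgraph.

(* The path with vertices x :: s, of length size s. *)
Definition is_path (x : X) (s : seq X) : bool :=
  path (@edge X) x s && uniq (x :: s).

Definition shortest_path (x : X) (s : seq X) : Prop :=
  is_path x s /\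
  forall t : seq X, is_path x t -> last x t = last x s -> size s <= size t.

Definition general_position (S : {set X}) : Prop :=
  forall a b c : X, a \in S -> b \in S -> c \in S -> uniq [:: a; b; c] ->
  ~ exists x s, shortest_path x s /\ {subset [:: a; b; c] <= x :: s}.

Definition gp : nat := \max_(S : {set X} | `[< general_position S >]) #|S|.

Definition isolated (S : {set X}) : {set X} :=
  [set x in S | [forall y in S, ~~ edge x y]].

Definition nonisolated (S : {set X}) : {set X} := S :\: isolated S.
End GeneralPosition.

Section Cliques.
Variable X : sgraph.

Definition clique (K : {set X}) : bool :=
  [forall x in K, forall y in K, (x != y) ==> edge x y].

Definition omega : nat := \max_(K : {set X} | clique K) #|K|.
End Cliques.

Section Steiner.
Variable X : sgraph.

Definition edges : {set {set X}} := [set [set p.1; p.2] | p : X * X & edge p.1 p.2].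

(* A subgraph of X is a pair (vertex set, edge set). *)
Definition is_subgraph (Y : {set X} * {set {set X}}) : bool :=
  (Y.2 \subset edges) && [forall e in Y.2, e \subset Y.1].

Definition subgraph_connected (Y : {set X} * {set {set X}}) : bool :=
  [forall x in Y.1, forall y in Y.1,
     connect [rel u v | [set u; v] \in Y.2] x y].

Definition connects (W : {set X}) (Y : {set X} * {set {set X}}) : bool :=
  [&& is_subgraph Y, subgraph_connected Y & W \subset Y.1].

(* None stands for an infinite distance. *)
Definition steiner_dist (W : {set X}) : option nat :=
  if [pick Y | connects W Y] is Some Y0
  then Some #|[arg min_(Y < Y0 | connects W Y) #|Y.2|].2|
  else None.
End Steiner.

(* As V(H[A]) = A, the 2-subsets of A are those of the vertex set of H[A]. *)
Definition join_critical2 (H : sgraph) (A : {set H}) : bool :=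
  (2 <= #|A|) &&
  [forall B : {set induced A}, (#|B| == 2) ==> (steiner_dist B != Some 2)].

Definition sjc2 (H : sgraph) : nat := \max_(A : {set H} | join_critical2 A) #|A|.

(* Main.v *)
(* In a connected graph, three vertices lie on a common geodesic iff the
   triangle inequality is an equality for some ordering of them.  In G o H the
   distance is that of G between different H-layers, while distinct nonadjacent
   vertices of one layer are at distance 2 through any neighbouring layer.
   Hence T is in general position iff its projection S to G is, each layer of T
   induces a disjoint union of cliques (this is 2-Steiner join-criticality),
   and the layers over nonisolated vertices of G[S] are cliques. *)
Require Import Defs.
From HB Require Import structures.
From mathcomp Require Import all_boot.
From mathcomp Require Import boolp.
From mathcomp Require Import zify.

Set Implicit Arguments.
Unset Strict Implicit.
Unset Printing Implicit Defensive.

(** * Distance in a graph, geodesics and general position *)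

Section Distance.
Variable X : sgraph.
Implicit Types (x y z : X) (s : seq X).

(** Tuples of a fixed length form a finite type, so existence is a boolean that [find] can test. *)
Definition walk n x y : bool :=
  [exists s : n.-tuple X, path (@edge X) x s && (last x s == y)].

(* Equal to [#|X|] when [x] and [y] are not connected. *)
Definition dist x y : nat := find (fun n => walk n x y) (iota 0 #|X|).

Lemma walkP n x y :
  reflect (exists s, [/\ path (@edge X) x s, last x s = y & size s = n])
          (walk n x y).
Proof.
apply: (iffP existsP) => [[s /andP[xs /eqP sy]]|[s [xs sy sn]]].
  by exists s; rewrite size_tuple.
by exists (Tuple (introT eqP sn)); rewrite /= xs sy eqxx.
Qed.

Lemma dist_le_walk n x y : walk n x y -> dist x y <= n.
Proof.
move=> w; rewrite leqNgt; apply/negP => lt_n.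
have n_lt : n < #|X|.
  by apply: leq_trans lt_n _; rewrite -[leqRHS](size_iota 0) find_size.
by have := before_find 0 lt_n; rewrite nth_iota // add0n w.
Qed.

Lemma dist_le_path x s : path (@edge X) x s -> dist x (last x s) <= size s.
Proof. by move=> xs; apply/dist_le_walk/walkP; exists s. Qed.

(** Removing repetitions from [s] gives a path of length below [#|X|], so the search defining [dist]
    succeeds within its range. *)
Lemma dist_path x s : path (@edge X) x s ->
  exists t, [/\ path (@edge X) x t, last x t = last x s
              & size t = dist x (last x s)].
Proof.
move=> xs; apply/walkP; rewrite /dist.
have hP : has (fun n => walk n x (last x s)) (iota 0 #|X|).
  case/shortenP: xs => t xt ut _.
  apply/hasP; exists (size t); last by apply/walkP; exists t.
  by have := max_card (mem (x :: t)); rewrite (card_uniqP ut) mem_iota.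
by have := nth_find 0 hP; rewrite nth_iota // -[ltnRHS](size_iota 0) -has_find.
Qed.

Lemma dist0 x : dist x x = 0.
Proof. by apply/eqP; rewrite -leqn0 (@dist_le_path x [::]). Qed.

Lemma dist_edge_le x y : edge x y -> dist x y <= 1.
Proof. by move=> xy; apply: (@dist_le_path x [:: y]); rewrite /= xy. Qed.

Hypothesis Xconn : connected X.

Lemma geodesic x y :
  exists s, [/\ path (@edge X) x s, last x s = y & size s = dist x y].
Proof. by have /connectP[s xs ->] := Xconn x y; apply: dist_path. Qed.

Lemma dist_triangle y x z : dist x z <= dist x y + dist y z.
Proof.
have [s [xs sy <-]] := geodesic x y; have [t [yt tz <-]] := geodesic y z.
by rewrite -size_cat -tz -sy -last_cat dist_le_path // cat_path xs sy.
Qed.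

Lemma dist_gt0 x y : (0 < dist x y) = (x != y).
Proof.
have [->|xy] := eqVneq x y; first by rewrite dist0.
have [[|z s] [_ /= sy <-]] := geodesic x y => //.
by rewrite sy eqxx in xy.
Qed.

Lemma dist_edge x y : edge x y = (dist x y == 1).
Proof.
apply/idP/eqP => [xy|xy1].
  have := dist_edge_le xy; have : 0 < dist x y; last by lia.
  by rewrite dist_gt0; apply: contraTneq xy => ->; rewrite edge_irrefl.
have [[|z [|z' s]] [/= xs sy]] := geodesic x y; rewrite xy1 //.
by rewrite -sy; case/andP: xs.
Qed.

Lemma dist_sym x y : dist x y = dist y x.
Proof.
suff le u v : dist u v <= dist v u by apply/eqP; rewrite eqn_leq !le.
have [s [vs su <-]] := geodesic v u.
have us : path (@edge X) u (rev (belast v s)).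
  by rewrite -su rev_path (eq_path (e' := @edge X)) // => a b; rewrite edge_sym.
apply: leq_trans (_ : size (rev (belast v s)) <= _); last by rewrite size_rev size_belast.
suff {1}<- : last u (rev (belast v s)) = v by apply: dist_le_path.
by case: s {vs us} su => [|w s] //=; rewrite rev_cons last_rcons.
Qed.

(** Removing repetitions keeps the endpoints and cannot shorten a walk of minimal length, so there
    were none. *)
Lemma minimal_path_uniq x s :
  path (@edge X) x s -> size s <= dist x (last x s) -> uniq (x :: s).
Proof.
move=> xs; case: {2 3}_ / (shortenP xs) => t xt ut ts s_min.
apply: leq_size_uniq ut _ _ => /= [y|].
  by rewrite !inE => /predU1P[->|/ts ->]; rewrite ?eqxx ?orbT.
by rewrite ltnS (leq_trans s_min) // dist_le_path.
Qed.

(** [shortest_path] compares with repetition-free paths, [dist] with all walks; both minima agree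
    because a minimal walk repeats no vertex. *)
Lemma shortest_pathP x s :
  shortest_path x s <-> path (@edge X) x s /\ dist x (last x s) = size s.
Proof.
split=> [[/andP[xs _] s_min]|[xs sz]].
  split=> //; apply/eqP; rewrite eqn_leq dist_le_path //=.
  have [t [xt tl t_min]] := dist_path xs; rewrite -t_min.
  apply: s_min => //; rewrite /is_path xt minimal_path_uniq //.
  by rewrite tl t_min.
split=> [|t /andP[xt _] tl]; first by rewrite /is_path xs minimal_path_uniq // sz.
by rewrite -sz -tl dist_le_path.
Qed.

(** Each segment bounds the distance of its ends from above. The segments before [i], from [i] to
    [j] and after [j] have total length [size s], the distance of the extremes, so the triangle
    inequality makes every bound tight. *)
Lemma dist_shortest_path x s i j : shortest_path x s -> i <= j <= size s ->
  dist (nth x (x :: s) i) (nth x (x :: s) j) = j - i.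
Proof.
move=> /shortest_pathP[xs sz] /andP[ij js]; set p := nth x (x :: s).
have le a b : a <= b <= size s -> dist (p a) (p b) <= b - a.
  elim: b => [|b IH] /andP[ab bs]; first by rewrite (_ : a = 0) ?dist0 //; lia.
  have [->|a_neq] := eqVneq a b.+1; first by rewrite dist0.
  apply: leq_trans (dist_triangle (p b) _ _) _.
  have := dist_edge_le (pathP x xs b bs); have := IH; rewrite -/p /p /=; lia.
have := le 0 i; have := le i j; have := le j (size s).
have := dist_triangle (p i) (p 0) (p (size s)).
have := dist_triangle (p j) (p i) (p (size s)).
have -> : p (size s) = last x s.
  by rewrite /p -[size s]/(size (x :: s)).-1 nth_last.
by have -> : p 0 = x by []; rewrite sz; lia.
Qed.

Lemma general_positionP (S : {set X}) :
  general_position S <-> forall a b c, a \in S -> b \in S -> c \in S ->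
    uniq [:: a; b; c] -> dist a b + dist b c <> dist a c.
Proof.
split=> gpS a b c aS bS cS abc.
  move=> abcE; have [s [xs sb s_sz]] := geodesic a b.
  have [t [bt tc t_sz]] := geodesic b c.
  (* Geodesics from [a] to [b] and from [b] to [c] concatenate to a geodesic, since their lengths
     add up to [dist a c]. *)
  apply: (gpS a b c) => //; exists a, (s ++ t); split.
    apply/shortest_pathP; rewrite cat_path last_cat sb xs bt tc size_cat.
    by rewrite s_sz t_sz.
  have bs : b \in a :: s by rewrite -sb mem_last.
  have := mem_last b t; rewrite tc => cbt y /[!inE] /or3P[]/eqP->.
  - by rewrite eqxx.
  - by rewrite -in_cons -cat_cons mem_cat bs.
  rewrite -in_cons -cat_cons mem_cat; move: cbt.
  by rewrite inE => /predU1P[->|->]; rewrite ?bs ?orbT.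
move=> [x [s [xs sub]]].
have pos y : y \in [:: a; b; c] -> exists2 i, i <= size s & y = nth x (x :: s) i.
  move=> /sub ys; exists (index y (x :: s)); last by rewrite nth_index.
  by rewrite -ltnS -[ltnRHS]/(size (x :: s)) index_mem.
(* Vertices listed in their order along the path turn the triangle inequality into an equality;
   every arrangement of [a], [b], [c] reduces to this one. *)
have D u v w : u \in S -> v \in S -> w \in S -> uniq [:: u; v; w] ->
    forall i j k, u = nth x (x :: s) i -> v = nth x (x :: s) j ->
    w = nth x (x :: s) k -> k <= size s -> i <= j <= k -> False.
  move=> uS vS wS uvw i j k ui vj wk ks /andP[ij jk].
  by apply: (gpS u v w) => //; rewrite ui vj wk !dist_shortest_path //; lia.
have [[i lei ai] [j lej bj] [k lek ck]] :
  [/\ exists2 i, i <= size s & a = nth x (x :: s) i,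
      exists2 i, i <= size s & b = nth x (x :: s) i
    & exists2 i, i <= size s & c = nth x (x :: s) i].
  by split; apply: pos; rewrite !inE eqxx ?orbT.
have uniqP u v w : perm_eq [:: u; v; w] [:: a; b; c] -> uniq [:: u; v; w].
  by move/perm_uniq->.
(* Two of the eight sign patterns are cyclic and contradictory; the other six are the orderings of
   the three positions. *)
have [ij|ji] := leqP i j; have [jk|kj] := leqP j k; have [ik|ki] := leqP i k.
all: try lia.
- by apply: (D a b c _ _ _ _ i j k) => //; lia.
- by apply: (D a c b _ _ _ _ i k j) => //; [apply: uniqP; rewrite perm_cons (perm_catC [:: c])|lia].
- apply: (D c a b _ _ _ _ k i j) => //; [|lia].
  by apply: uniqP; rewrite (perm_catC [:: c]).
- apply: (D b a c _ _ _ _ j i k) => //; [|lia].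
  by apply: uniqP; rewrite (perm_catCA [:: b] [:: a] [:: c]).
- apply: (D b c a _ _ _ _ j k i) => //; [|lia].
  by apply: uniqP; rewrite (perm_catC [:: b; c]).
- apply: (D c b a _ _ _ _ k j i) => //; [|lia].
  by apply: uniqP; rewrite -[[:: c; b; a]]/(rev [:: a; b; c]) perm_rev.
Qed.
End Distance.

(** * Distances in the lexicographic product *)

Section LexprodDistance.
Variables G H : sgraph.
Hypotheses (G_nontrivial : nontrivial G) (G_connected : connected G).

Lemma exists_neighbor (g : G) : exists g', edge g g'.
Proof.
have [g' g'g] : exists g', g' != g.
  move: G_nontrivial; rewrite /nontrivial (cardD1 g) inE.
  by case/card_gt0P => g' /[!inE] /andP[]; exists g'.
have /connectP[[|g1 s] /=] := G_connected g g'; last by case/andP; exists g1.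
by move=> _ g'E; rewrite g'E eqxx in g'g.
Qed.

(** Adjacency between different layers ignores second coordinates, so the first step can already
    switch from [h] to [h']. *)
Lemma lex_path_lift (g : G) (h h' : H) s : path (@edge G) g s ->
  path (@edge (lexprod G H)) (g, h) [seq (x, h') | x <- s].
Proof. by elim: s g h => //= x s IH g h /andP[gx /IH ->]; rewrite /lex_edge /= gx. Qed.

Lemma lex_path_via (g g' : G) (h h' : H) : edge g g' ->
  path (@edge (lexprod G H)) (g, h) [:: (g', h); (g, h')].
Proof. by move=> gg'; rewrite /= /lex_edge /= gg' edge_sym gg'. Qed.

Lemma lexprod_connected : connected (lexprod G H).
Proof.
move=> [g h] [g' h']; apply/connectP; have [<-|gg'] := eqVneq g g'.
  by have [g1 gg1] := exists_neighbor g; exists [:: (g1, h); (g, h')]; first exact: lex_path_via.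
have [s [gs sg' _]] := geodesic G_connected g g'.
exists [seq (x, h') | x <- s]; first exact: lex_path_lift.
case: s gs sg' => [|x s] _ /= sg'; first by rewrite sg' eqxx in gg'.
by rewrite (last_map (fun x => (x, h'))) sg'.
Qed.

(** Projection to [G] sends each edge of the product to an edge or to a single vertex. *)
Lemma lex_dist_ge (u v : lexprod G H) : dist u.1 v.1 <= dist u v.
Proof.
have [s [us sv <-]] := geodesic lexprod_connected u v; rewrite -{}sv.
elim: s u us => [|w s IH] u /=; first by rewrite dist0.
case/andP=> uw /IH le; apply: leq_trans (dist_triangle G_connected w.1 _ _) _.
rewrite -add1n leq_add //; case/orP: uw => [/dist_edge_le //|/andP[/eqP-> _]].
by rewrite dist0.
Qed.

Lemma lex_dist_neq (u v : lexprod G H) : u.1 != v.1 -> dist u v = dist u.1 v.1.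
Proof.
case: u v => [g h] [g' h'] /= gg'; apply/eqP.
rewrite eqn_leq (lex_dist_ge (g, h) (g', h')) andbT.
have [s [gs sg' <-]] := geodesic G_connected g g'.
apply/dist_le_walk/walkP; exists [seq (x, h') | x <- s].
rewrite size_map lex_path_lift //; split=> //.
(* The lift ends at second coordinate [h'] only if it takes a step, which distinct layers
   guarantee. *)
case: s gs sg' => [|x s] _ /= sg'; first by rewrite sg' eqxx in gg'.
by rewrite (last_map (fun x => (x, h'))) sg'.
Qed.

(** The boolean counts as 0 or 1, so the value is 1 or 2; a detour through a neighboring layer gives
    the bound 2. *)
Lemma lex_dist_layer (g : G) (h h' : H) : h != h' ->
  dist ((g, h) : lexprod G H) (g, h') = (~~ edge h h').+1.
Proof.
move=> hh'; have := dist_edge lexprod_connected (g, h) (g, h').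
have := dist_gt0 lexprod_connected (g, h) (g, h').
rewrite /= /lex_edge /= edge_irrefl eqxx xpair_eqE eqxx hh' /=.
have [g1 gg1] := exists_neighbor g.
have /dist_le_path /= := lex_path_via h h' gg1.
by case: edge => /=; case: dist => [|[|[|]]].
Qed.
End LexprodDistance.

(** * Steiner join-critical sets as disjoint unions of cliques *)

Section JoinCritical.
Variable H : sgraph.
Implicit Types A K : {set H}.

(** Absence of an induced path on three vertices; unlike [join_critical2], it admits sets with fewer
    than two elements, such as empty layers. *)
Definition cluster A : Prop := forall x y z, x \in A -> y \in A -> z \in A ->
  edge x y -> edge y z -> x != z -> edge x z.

Lemma mem_edges (X : sgraph) (x y : X) : ([set x; y] \in edges X) = edge x y.
Proof.
apply/imsetP/idP => [[[u v] /[!inE] /= uv xyE]|xy]; last by exists (x, y); rewrite ?inE.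
have : x \in [set u; v] by rewrite -xyE set21.
have : y \in [set u; v] by rewrite -xyE set22.
have uu : u \in [set x; y] by rewrite xyE set21.
have vv : v \in [set x; y] by rewrite xyE set22.
move: uu vv; rewrite !inE => uu vv /orP[]/eqP yE /orP[]/eqP xE; subst => //.
- by rewrite !orbb in vv; rewrite (eqP vv) edge_irrefl in uv.
- by rewrite edge_sym.
- by rewrite !orbb in uu; rewrite (eqP uu) edge_irrefl in uv.
Qed.

Lemma connects_edge (X : sgraph) (x y : X) : edge x y ->
  connects [set x; y] ([set x; y], [set [set x; y]]).
Proof.
move=> xy; apply/and3P; split=> //=.
- rewrite /is_subgraph /= sub1set mem_edges xy.
  by apply/forall_inP => e /set1P->.
apply/forall_inP => u /= uP; apply/forall_inP => v /= vP.
move: uP vP; rewrite !inE => /orP[]/eqP-> /orP[]/eqP->; rewrite ?connect0 //.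
all: by apply: connect1; rewrite /= inE ?eqxx // setUC.
Qed.

Lemma connects_cherry (X : sgraph) (x y z : X) : edge x y -> edge y z ->
  connects [set x; z] ([set x; y; z], [set [set x; y]; [set y; z]]).
Proof.
move=> xy yz; apply/and3P; split=> /=.
- rewrite /is_subgraph /= subUset !sub1set !mem_edges xy yz.
  apply/forall_inP => e /set2P[]->; apply/subsetP => w; rewrite !inE.
    by move=> /orP[]->; rewrite ?orbT.
  by move=> /orP[]->; rewrite ?orbT.
- pose e : rel X := [rel u v | [set u; v] \in [set [set x; y]; [set y; z]]].
  have e_sym : connect_sym e by apply: sym_connect_sym => u v; rewrite /e /= [[set u; v]]setUC.
  have cy u : u \in [set x; y; z] -> connect e u y.
    rewrite !inE => /orP[/orP[]|]/eqP->; rewrite ?connect0 //.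
      by apply: connect1; rewrite /e /= !inE eqxx.
    by rewrite e_sym; apply: connect1; rewrite /e /= !inE eqxx orbT.
  apply/forall_inP => u /cy uy; apply/forall_inP => v /cy vy.
  by apply: (connect_trans uy); rewrite e_sym.
by apply/subsetP => w; rewrite !inE => /orP[]->; rewrite ?orbT.
Qed.

Lemma steiner_distP (X : sgraph) (W : {set X}) n : steiner_dist W = Some n <->
  (exists2 Y, connects W Y & #|Y.2| = n) /\ (forall Y, connects W Y -> n <= #|Y.2|).
Proof.
rewrite /steiner_dist; case: pickP => [Y0 Y0W|noY]; last first.
  by split=> // -[[Y YW]]; rewrite noY in YW.
case: arg_minnP => // Y1 Y1W Y1_min; split=> [[<-]|[[Y YW <-] Y_min]].
  by split=> //; exists Y1.
by congr Some; apply/eqP; rewrite eqn_leq Y1_min ?Y_min.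
Qed.

Lemma steiner_dist_pair2 (X : sgraph) (x z : X) : x != z ->
  steiner_dist [set x; z] = Some 2 <->
  ~~ edge x z /\ (exists2 Y, connects [set x; z] Y & #|Y.2| = 2).
Proof.
move=> xz; split=> [/steiner_distP[Y Y_min]|[nxz YE]].
  split=> //; by apply/negP => /connects_edge/Y_min; rewrite cards1.
apply/steiner_distP; split=> // Y /and3P[/andP[/subsetP Ye _] /forall_inP Yc /subsetP YW].
have /forall_inP/(_ z (YW z (set22 x z))) := Yc _ (YW x (set21 x z)).
case/connectP => s; case: s => [|u s] /=; first by move=> _ zE; rewrite zE eqxx in xz.
case/andP => xu us zE.
have [zu|zu] := eqVneq z u; first by rewrite -zu in xu; rewrite -mem_edges Ye in nxz.
case/lastP: s us zE => [|s w] us; first by move=> /= zE; rewrite zE eqxx in zu.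
rewrite last_rcons => zE; subst w.
move: us; rewrite rcons_path /= => /andP[_ wz].
(* The first and last edges of the path from [x] to [z] in [Y] are distinct, because [z] is neither
   [x] nor [u]. *)
apply: leq_trans (_ : #|[set [set x; u]; [set last u s; z]]| <= _).
  rewrite cards2 ltnS lt0b; apply: contra_neq xz => E.
  have : z \in [set x; u] by rewrite E set22.
  by rewrite !inE (negbTE zu) orbF => /eqP.
by rewrite subset_leq_card // subUset !sub1set xu.
Qed.

(** An induced path on three vertices has ends at Steiner distance 2. Without one, vertices joined
    by a connected subgraph are equal or adjacent, which excludes the value 2. *)
Lemma join_critical2P A : reflect (1 < #|A| /\ cluster A) (join_critical2 A).
Proof.
apply: (iffP andP) => -[A2 AP]; split=> //.
  move=> x y z xA yA zA xy yz xz; apply: contraT => nxz.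
  pose X := induced A; pose x' : X := Sub x xA; pose y' : X := Sub y yA.
  pose z' : X := Sub z zA.
  have xz' : x' != z' by rewrite -val_eqE.
  move/forallP/(_ [set x'; z'])/implyP: AP.
  rewrite cards2 xz' => /(_ isT)/eqP[]; apply/steiner_dist_pair2 => //; split=> //.
  exists ([set x'; y'; z'], [set [set x'; y']; [set y'; z']]).
    exact: connects_cherry.
  rewrite /= cards2; case: eqVneq => // E.
  have : x' \in [set y'; z'] by rewrite -E set21.
  rewrite !inE (negbTE xz') orbF -val_eqE /= => /eqP xyE.
  by rewrite xyE edge_irrefl in xy.
apply/forallP => B; apply/implyP => /cards2P[x [z [xz ->]]].
apply/eqP => /(steiner_dist_pair2 xz)[/negP nxz [Y Ycon _]]; apply: nxz.
case/and3P: Ycon => [/andP[/subsetP Ye _] /forall_inP Yc /subsetP YW].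
have /forall_inP/(_ z (YW z (set22 x z))) := Yc _ (YW x (set21 x z)).
case/connectP => s sp zE; move: xz.
suff: (x == z) || edge x z by case: eqP.
(* Along the path every vertex stays equal or adjacent to [x]: [cluster] carries this across each
   new edge. *)
rewrite zE; elim/last_ind: s {zE} sp => [|s w IH]; first by rewrite eqxx.
rewrite rcons_path last_rcons => /andP[/IH IHs /Ye]; rewrite mem_edges => sw.
case/predU1P: IHs => [xE|xs]; first by rewrite [X in edge X _]xE sw orbT.
have [//|xw /=] := eqVneq x w.
apply: (AP _ _ _ (valP x) (valP (last x s)) (valP w) xs sw).
by apply: contra_neq xw => /val_inj.
Qed.

Lemma sjc2_ge A : nontrivial H -> cluster A -> #|A| <= sjc2 H.
Proof.
move=> H2 Acl; have [A2|A1] := ltnP 1 #|A|.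
  by rewrite leq_bigmax_cond //; apply/join_critical2P.
(* A set with at most one element is not a candidate in the maximum, but any two vertices of [H]
   form one. *)
apply: leq_trans A1 _; have /card_gt1P[x [y [_ _ xy]]] := H2.
apply: leq_trans (_ : #|[set x; y]| <= _); first by rewrite cards2.
rewrite leq_bigmax_cond //; apply/join_critical2P; rewrite cards2 xy; split=> //.
by move=> u v w /set2P[]-> /set2P[]-> /set2P[]->; rewrite ?edge_irrefl ?eqxx.
Qed.

(** Any pair of vertices is a candidate, so the maximum is attained and is not the default 0 of an
    empty family. *)
Lemma sjc2_witness : nontrivial H -> exists2 A, cluster A & #|A| = sjc2 H.
Proof.
move=> H2; have [|A /join_critical2P[_ Acl] AE] := @eq_bigmax_cond _ (@join_critical2 H) (fun A => #|A|).
  apply/card_gt0P; have /card_gt1P[x [y [_ _ xy]]] := H2.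
  exists [set x; y]; apply/join_critical2P; rewrite cards2 xy; split=> //.
  by move=> u v w /set2P[]-> /set2P[]-> /set2P[]->; rewrite ?edge_irrefl ?eqxx.
by exists A.
Qed.

Lemma cliqueP K : reflect {in K &, forall x y, x != y -> edge x y} (clique K).
Proof.
apply: (iffP forall_inP) => [Kc x y xK yK xy|Kc x xK].
  by have /forall_inP/(_ y yK)/implyP := Kc x xK; apply.
by apply/forall_inP => y yK; apply/implyP; apply: Kc.
Qed.

Lemma omega_witness : exists2 K : {set H}, clique K & #|K| = omega H.
Proof.
have [|K Kc KE] := @eq_bigmax_cond _ (@clique H) (fun K => #|K|); last by exists K.
by apply/card_gt0P; exists set0; apply/cliqueP => x; rewrite inE.
Qed.
End JoinCritical.

(** * General position in the product, read off from the projection and the layers *)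

Section LexprodGeneralPosition.
Variables G H : sgraph.
Hypotheses (G_nontrivial : nontrivial G) (G_connected : connected G).
Implicit Types (S : {set G}) (T : {set lexprod G H}).

Lemma nonisolatedP S g :
  reflect (g \in S /\ exists2 g', g' \in S & edge g g') (g \in nonisolated S).
Proof.
rewrite in_setD inE; case: (boolP (g \in S)) => gS; last by apply: ReflectF => -[].
rewrite andbT; apply: (iffP forall_inPn) => [[g' g'S /negPn]|[_ [g' g'S gg']]].
  by split=> //; exists g'.
by exists g'; rewrite ?gg'.
Qed.

Lemma isolated_sub S : isolated S \subset S.
Proof. by apply/subsetP => g /[!inE] /andP[]. Qed.

Definition layer T (g : G) : {set H} := [set h | (g, h) \in T].

Lemma card_layers T : #|T| = \sum_(g in [set u.1 | u in T]) #|layer T g|.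
Proof.
rewrite -sum1_card (partition_big_imset (fun u : lexprod G H => u.1)) /=.
apply: eq_bigr => g _; rewrite -sum1_card.
rewrite (reindex_onto (fun h => (g, h) : lexprod G H) (fun u => u.2)) /=; last first.
  by move=> [g' h] /= /andP[_ /eqP->].
by apply: eq_bigl => h; rewrite inE /= !eqxx !andbT.
Qed.

Lemma lex_general_positionP T :
  general_position T <->
  [/\ general_position [set u.1 | u in T],
      forall g, cluster (layer T g)
    & forall g, g \in nonisolated [set u.1 | u in T] -> clique (layer T g)].
Proof.
have lexc := lexprod_connected (H := H) G_nontrivial G_connected.
have ldist := lex_dist_layer (H := H) G_nontrivial G_connected.
have ndist := lex_dist_neq (H := H) G_nontrivial G_connected.
split=> [/(general_positionP lexc) gpT|[/(general_positionP G_connected) gpS Tcl Tk]].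
  split.
  - apply/(general_positionP G_connected) => _ _ _
      /imsetP[a aT ->] /imsetP[b bT ->] /imsetP[c cT ->] abc.
    have := abc; rewrite /= !inE negb_or andbT.
    move=> /andP[/andP[ab ac] bc]; rewrite -!ndist //; apply: gpT => //.
    exact: (@map_uniq _ _ (fun u : G * H => u.1)).
  - move=> g x y z /[!inE] xT yT zT xy yz xz; apply: contraT => nxz.
    have neq u v : edge u v -> u != v :> H.
      by apply: contraTneq => ->; rewrite edge_irrefl.
    (* An induced path in a layer would give the forbidden equality 1 + 1 = 2. *)
    have /= := gpT (g, x) (g, y) (g, z) xT yT zT.
    rewrite !inE !xpair_eqE eqxx /= negb_or xz !neq //= => /(_ isT).
    by rewrite !ldist ?(neq x y) ?(neq y z) // xy yz nxz.
  - move=> g /nonisolatedP[_ [_ /imsetP[[g' h'] g'T ->] /= gg']].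
    apply/cliqueP => x y /[!inE] xT yT xy; apply: contraT => nxy.
    have gNg' : g != g' by apply: contraTneq gg' => ->; rewrite edge_irrefl.
    (* A vertex of an adjacent layer lies midway between two nonadjacent vertices of layer [g]. *)
    have /= := gpT (g, x) (g', h') (g, y) xT g'T yT.
    rewrite !inE !xpair_eqE eqxx /= negb_or xy andbT (negbTE gNg').
    rewrite [g' == g]eq_sym (negbTE gNg') => /(_ isT).
    rewrite ldist // nxy !ndist //= 1?eq_sym // (dist_sym G_connected g').
    by move: gg'; rewrite dist_edge // => /eqP->.
apply/(general_positionP lexc) => -[g x] [g' y] [g'' z] aT bT cT.
have S1 u : u \in T -> u.1 \in [set u.1 | u in T] by apply: imset_f.
have inl k h : ((k, h) \in T) = (h \in layer T k) by rewrite inE.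
rewrite /= !inE !xpair_eqE negb_or andbT => /andP[/andP[ab ac] bc].
(* The cases follow the coincidences among first coordinates. If the middle vertex shares its layer
   with exactly one other, two of the distances agree and the third is positive, so equality
   fails. *)
have [gg'|gg'] := eqVneq g g'; first subst g'.
  rewrite eqxx /= in ab; rewrite ldist //.
  have [gg''|gg''] := eqVneq g g''; last by rewrite !ndist //=; lia.
  subst g''; rewrite eqxx /= in ac bc; rewrite !ldist //.
  case: (boolP (edge x y)) => xy; case: (boolP (edge y z)) => yz; try by case: edge.
  by rewrite (Tcl g x y z) // -inl.
have [g'g''|g'g''] := eqVneq g' g''; first subst g''.
  by rewrite eqxx /= in bc; rewrite ldist // !ndist //=; lia.
have [gg''|gg''] := eqVneq g g''; last first.
  rewrite !ndist //=; apply: gpS; rewrite ?(S1 _ aT) ?(S1 _ bT) ?(S1 _ cT) //.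
  by rewrite /= !inE negb_or gg' gg'' g'g''.
(* Only the outer vertices share a layer, and the left side is twice [dist g g']. For adjacent [g],
   [g'] it is 2, while the clique layer gives 1 on the right; otherwise it is at least 4, against at
   most 2. *)
subst g''; rewrite eqxx /= in ac; rewrite ldist // !ndist //= (dist_sym G_connected g').
have [gE|ngE] := boolP (edge g g').
  have /Tk/cliqueP -> // : g \in nonisolated [set u.1 | u in T].
  - apply/nonisolatedP; split; first exact: (S1 _ aT).
    by exists g' => //; apply: (S1 _ bT).
  - by rewrite /=; lia.
  - by rewrite -inl.
  - by rewrite -inl.
move: ngE; rewrite dist_edge //; have := dist_gt0 G_connected g g'.
by rewrite gg'; case: edge => /=; lia.
Qed.
End LexprodGeneralPosition.

(** * The formula for [gp], by an upper bound and a construction *)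

Theorem theorem5p3 (G H : sgraph) (G_nontrivial : nontrivial G)
    (H_nontrivial : nontrivial H) (G_connected : connected G) :
  gp (lexprod G H) =
  \max_(S : {set G} | `[< general_position S >])
     (#|isolated S| * sjc2 H + #|nonisolated S| * omega H).
Proof.
have gpP := lex_general_positionP (H := H) G_nontrivial G_connected.
apply/eqP; rewrite eqn_leq; apply/andP; split; apply/bigmax_leqP.
  move=> T /asboolP/gpP[gpS Tcl Tk]; set S := [set u.1 | u in T] in gpS Tk.
  apply: leq_trans (leq_bigmax_cond _ (introT (asboolP _) gpS)).
  (* Counting [T] by layers, those over isolated vertices of [S] are clusters and the others are
     cliques. *)
  rewrite card_layers -/S (big_setID (isolated S)) /=.
  rewrite (setIidPr (isolated_sub S)) -!sum_nat_const.
  apply: leq_add; apply: leq_sum => g gS; first exact: sjc2_ge.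
  by rewrite leq_bigmax_cond //; apply: Tk.
move=> S /asboolP gpS.
have [A Acl <-] := sjc2_witness H_nontrivial; have [K Kc <-] := omega_witness H.
(* Extremal layers: a largest cluster over isolated vertices, a largest clique over the rest. *)
set T : {set lexprod G H} := setX (isolated S) A :|: setX (nonisolated S) K.
have disj : [disjoint setX (isolated S) A & setX (nonisolated S) K].
  apply/pred0P => -[g h]; rewrite /= !in_setX in_setD.
  by case: (g \in isolated S); rewrite ?andbF.
have TE g h : ((g, h) \in T) =
    if g \in isolated S then h \in A else (g \in S) && (h \in K).
  by rewrite in_setU !in_setX in_setD; case: ifP; rewrite ?orbF.
rewrite -!cardsX -cardsUI (disjoint_setI0 disj) cards0 addn0 -/T.
suff gpT : general_position T by apply: leq_bigmax_cond; apply/asboolP.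
(* Inclusion suffices: general position passes to subsets, and a vertex nonisolated in the
   projection is nonisolated in [S]. *)
have TS : [set u.1 | u in T] \subset S.
  apply/subsetP => _ /imsetP[[g h] + ->] /=; rewrite TE.
  by case: ifP => [/(subsetP (isolated_sub S))|_ /andP[]].
have layerE g : layer T g = if g \in isolated S then A else if g \in S then K else set0.
  by apply/setP => h; rewrite inE TE; do 2?case: ifP; rewrite ?inE.
apply/gpP; split.
- by move=> a b c /(subsetP TS) aS /(subsetP TS) bS /(subsetP TS) cS; apply: gpS.
- move=> g; rewrite layerE; do 2?case: ifP => // _; last by move=> x; rewrite inE.
  by move=> x y z xK yK zK _ _; apply: (cliqueP K Kc).
- move=> g /nonisolatedP[/(subsetP TS) gS [g' /(subsetP TS) g'S gg']].
  have : g \in nonisolated S by apply/nonisolatedP; split=> //; exists g'.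
  by rewrite layerE in_setD gS andbT => /negbTE->.
Qed.
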